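(* For all integers $n\ge3$ and $1\le m\le n-2$, $$\sup_{x\in\mathbb{R}}|F_{n,m}(x)-\Phi(x)|\le C\,\frac nm\,\frac1{\sigma_n},$$ where $C=9.257$.
   Context: Coupon collector's waiting time: coupons are drawn independently and uniformly at random with replacement from $n$ distinct coupons, and $W_{n,m}$ is the number of draws until $n-m$ distinct coupons have been collected for the first time. Equivalently, $W_{n,m}$ is distributed as a sum of independent geometric random variables (on $\{1,2,\ldots\}$) with success probabilities $k/n$, $k=m+1,\ldots,n$. Its mean and variance are $\mu_n=n\sum_{k=m+1}^n\frac1k$ and $\sigma_n^2=n\sum_{k=m+1}^n\frac{n-k}{k^2}$ (with $\sigma_n\geq 0$). Put $F_{n,m}(x)=\mathbf P\big(\frac{W_{n,m}-\mu_n}{\sigma_n}\le x\big)$ and $\Phi(x)=\frac1{\sqrt{2\pi}}\int_{-\infty}^xe^{-s^2/2}\,ds$, $x\in\mathbb{R}$. *)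

(* Defs.v *)
From HB Require Import structures.
From mathcomp Require Export all_boot all_order all_algebra.
From mathcomp Require Export finmap.
From mathcomp Require Export all_classical all_reals all_analysis.

Set Implicit Arguments.
Unset Strict Implicit.
Unset Printing Implicit Defensive.

Import Order.TTheory GRing.Theory Num.Theory.

Local Open Scope classical_set_scope.
Local Open Scope ring_scope.

(* ['I_n] carries its discrete sigma-algebra, so [B] ranges over all sets. *)
Definition mutually_independent d (T : measurableType d) (R : realType)
    (P : probability T R) (n : nat) (X : nat -> T -> 'I_n) : Prop :=
  forall (J : {fset nat}) (B : nat -> set 'I_n),
    P (\bigcap_(i in [set` J]) (X i @^-1` B i)) =
    (\prod_(i <- J) P (X i @^-1` B i))%E.

(* [X i] is the coupon obtained at draw number [i.+1]. *)
Record coupon_draws d (T : measurableType d) (R : realType)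
    (P : probability T R) (n : nat) (X : nat -> T -> 'I_n) : Prop := {
  draws_measurable : forall i k, measurable (X i @^-1` [set k]) ;
  draws_uniform : forall i k, P (X i @^-1` [set k]) = (n%:R^-1)%:E ;
  draws_independent : mutually_independent P X }.

Definition num_distinct (T : Type) (n : nat) (X : nat -> T -> 'I_n)
    (t : nat) (w : T) : nat :=
  size (undup [seq X i w | i <- iota 0 t]).

(* W_{n,m}: on the null event where [n - m] distinct coupons are never
   collected the infimum is over the empty set, and the value is +oo. *)
Definition waiting_time (R : realType) (T : Type) (n : nat)
    (X : nat -> T -> 'I_n) (m : nat) (w : T) : \bar R :=
  ereal_inf [set (t%:R)%:E | t in
    [set t : nat | num_distinct X t w = (n - m)%N]].

Definition coupon_mean (R : realType) (n m : nat) : R :=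
  n%:R * \sum_(m.+1 <= k < n.+1) k%:R^-1.

Definition coupon_variance (R : realType) (n m : nat) : R :=
  n%:R * \sum_(m.+1 <= k < n.+1) (n%:R - k%:R) / k%:R ^+ 2.

Definition coupon_sd (R : realType) (n m : nat) : R :=
  Num.sqrt (coupon_variance R n m).

Definition coupon_cdf d (T : measurableType d) (R : realType)
    (P : probability T R) (n : nat) (X : nat -> T -> 'I_n) (m : nat)
    (x : R) : R :=
  fine (P [set w | ((waiting_time R X m w - (coupon_mean R n m)%:E)
                     * ((coupon_sd R n m)^-1)%:E <= x%:E)%E]).

Definition std_normal_cdf (R : realType) (x : R) : R :=
  (Num.sqrt (2 * pi))^-1 *
  \int[@lebesgue_measure R]_(s in `]-oo, x]) expR (- (s ^+ 2) / 2).

(* Main.v *)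
Require Import Defs.
From HB Require Import structures.
From mathcomp Require Import all_boot all_order all_algebra.
From mathcomp Require Import finmap.
From mathcomp Require Import all_classical all_reals all_analysis.
From mathcomp Require Import ring lra zify.

(* W is a sum of independent geometric variables G_k of parameters p_k, and a
   geometric variable has an explicit discrete Stein kernel:
     E[(G - 1/p) f(G)] = E[(q/p) G (f(G+1) - f(G))],  q = 1 - p.
   Summing, E[(W - mu) f(W)] = E[T (f(W+1) - f(W))] where T = sum (q_k/p_k) G_k
   has mean sigma^2 and variance sum q_k^3/p_k^4 <= (n/m)^2 sigma^2.  Let f be
   the solution of Stein's equation f'(w) = w f(w) + 1(w <= z) - Phi(z), at a
   point z of the lattice of values of (W - mu)/sigma.  There f' never jumps
   between two successive lattice points, so that 1(w < z) - Phi(z) is a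
   difference quotient of f minus w f(w), up to O(1/sigma); taking expectations,
   P(W < J) - Phi(z) is bounded by sup|f'| E|1 - T/sigma^2| + O(1/sigma), hence
   by a multiple of (n/m)/sigma.  An arbitrary x is at distance at most 1/sigma
   from the lattice, or to its left. *)

Set Implicit Arguments.
Unset Strict Implicit.
Unset Printing Implicit Defensive.

Import Order.TTheory GRing.Theory Num.Theory.
Import numFieldNormedType.Exports.

Local Open Scope classical_set_scope.
Local Open Scope ring_scope.

(** * Sums of independent geometric variables *)

Section GeometricFilter.
Variable R : realType.
Implicit Types (q : R) (b : R ^nat).

(* Coefficients of the power series [z b(z) / (1 - q z)]. *)
Fixpoint geom_filter q b (j : nat) : R :=
  if j is i.+1 then q * geom_filter q b i + b i else 0.

Lemma series_geom_filter q b N :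
  series (geom_filter q b) N.+1 = q * series (geom_filter q b) N + series b N.
Proof.
rewrite /series /= big_nat_recl// add0r mulr_sumr -big_split.
by apply: eq_bigr.
Qed.

(** The limit is the fixed point of [x -> q x + l]; the distance to it contracts by [q] at each
    step, up to the error on [b]. *)
Lemma cvg_affine_recurrence q (x b : R ^nat) (l : R) : 0 <= q < 1 ->
  (forall N, x N.+1 = q * x N + b N) -> b @ \oo --> l ->
  x @ \oo --> l / (1 - q).
Proof.
move=> /andP[q0 q1] xS bl.
have q1' : 0 < 1 - q by rewrite subr_gt0.
set L := l / (1 - q).
have LE : L = q * L + l.
  by rewrite /L; field; rewrite gt_eqF.
apply/cvgrPdist_le => e e0.
(* An error [e * (1 - q) / 2] per step accumulates geometrically to at most [e / 2]. *)
have e2 : 0 < e * (1 - q) / 2 by rewrite divr_gt0// mulr_gt0.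
have [M _ HM] : \forall n \near \oo, `|l - b n| <= e * (1 - q) / 2.
  by move/cvgrPdist_le : bl; apply.
have step k : `|L - x (k + M)%N| <= q ^+ k * `|L - x M| + e / 2.
  elim: k => [|k IH].
    by rewrite add0n expr0 mul1r lerDl divr_ge0// ltW.
  rewrite addSn xS [X in X - _]LE.
  have -> : q * L + l - (q * x (k + M)%N + b (k + M)%N) =
    q * (L - x (k + M)%N) + (l - b (k + M)%N) by ring.
  rewrite (le_trans (ler_normD _ _))// normrM (ger0_norm q0).
  have := HM (k + M)%N (leq_addl _ _).
  have := ler_wpM2l q0 IH.
  rewrite exprS; nra.
have : (fun k => q ^+ k * `|L - x M|) @ \oo --> 0 * `|L - x M|.
  apply: cvgMl; apply: cvg_expr; by rewrite ger0_norm.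
rewrite mul0r => /cvgrPdist_le /(_ (e / 2)).
rewrite divr_gt0// => /(_ isT) [M2 _ HM2].
exists (M2 + M)%N => // N /= MN.
have /HM2 : (M2 <= N - M)%N.
  by rewrite leq_subRL ?(leq_trans _ MN) ?leq_addl// addnC.
have -> : N = ((N - M) + M)%N by rewrite subnK// (leq_trans _ MN) ?leq_addl.
rewrite addnK /= sub0r normrN => H.
have := step (N - M)%N; have := ler_norm (q ^+ (N - M) * `|L - x M|); lra.
Qed.

Lemma cvg_series_geom_filter q b (l : R) : 0 <= q < 1 ->
  series b @ \oo --> l -> series (geom_filter q b) @ \oo --> l / (1 - q).
Proof.
by move=> q01; apply: cvg_affine_recurrence => // N; exact: series_geom_filter.
Qed.

Lemma geom_filter_ge0 q b : 0 <= q -> (forall j, 0 <= b j) ->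
  forall j, 0 <= geom_filter q b j.
Proof. by move=> q0 b0; elim=> //= j IH; rewrite addr_ge0// mulr_ge0. Qed.

Lemma series_le_lim (u : R ^nat) (l : R) : (forall j, 0 <= u j) ->
  series u @ \oo --> l -> forall N, \sum_(0 <= j < N) u j <= l.
Proof.
move=> u0 ul N; have <- := cvg_lim (@Rhausdorff R) ul.
apply: (@nondecreasing_cvgn_le _ (series u)); last by apply: cvgP ul.
exact: nondecreasing_series.
Qed.

Lemma cvg_series_shift (u : R ^nat) (l : R) : u 0 = 0 ->
  series u @ \oo --> l -> series (fun i => u i.+1) @ \oo --> l.
Proof.
move=> u0 ul; have -> : series (fun i => u i.+1) = (fun N => series u N.+1).
  by apply/funext => N; rewrite /series /= big_nat_recl// u0 add0r.
by rewrite (cvg_shiftS (series u)).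
Qed.

Lemma cvg_series_lin (u v : R ^nat) (a b l k : R) :
  series u @ \oo --> l -> series v @ \oo --> k ->
  series (fun i => a * u i + b * v i) @ \oo --> a * l + b * k.
Proof.
move=> ul vk.
have -> : series (fun i => a * u i + b * v i) =
    (fun N => a * series u N + b * series v N).
  by apply/funext => N; rewrite /series /= !mulr_sumr -big_split.
by apply: cvgD; apply: cvgMr.
Qed.

End GeometricFilter.

(** * The law of a sum of geometric variables and its Stein kernel *)

Section GeometricSum.
Variables (R : realType) (p : R ^nat).

Definition geom_ratio d : R := (1 - p d) / p d.

(* With [W = sum_(d < r) G_d] a sum of independent geometric variables of
   parameters [p d] and [T = sum_(d < r) geom_ratio d * G_d], the three
   sequences below are [P(W = j)], [E(T; W = j)] and [E(T^2; W = j)]; their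
   recurrences come from the decomposition [G = 1] or [G = 1 + G']. *)
Fixpoint geom_sum_pmf (r : nat) : R ^nat :=
  if r is d.+1 then geom_filter (1 - p d) (fun i => p d * geom_sum_pmf d i)
  else fun j => (j == 0)%:R.

Fixpoint geom_sum_kernel (r : nat) : R ^nat :=
  if r is d.+1 then geom_filter (1 - p d)
    (fun i => p d * geom_sum_kernel d i
              + geom_ratio d * geom_sum_pmf d.+1 i.+1)
  else fun=> 0.

Fixpoint geom_sum_kernel2 (r : nat) : R ^nat :=
  if r is d.+1 then geom_filter (1 - p d)
    (fun i => p d * geom_sum_kernel2 d i
              + (2 * geom_ratio d * geom_sum_kernel d.+1 i.+1
                 - geom_ratio d ^+ 2 * geom_sum_pmf d.+1 i.+1))
  else fun=> 0.

Definition geom_sum_mean r : R := \sum_(d < r) (p d)^-1.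
Definition geom_sum_variance r : R := \sum_(d < r) (1 - p d) / p d ^+ 2.

Notation pi_ := geom_sum_pmf.
Notation tau := geom_sum_kernel.
Notation rho := geom_sum_kernel2.
Notation mean := geom_sum_mean.
Notation var := geom_sum_variance.

Lemma geom_sum_pmfS d j :
  pi_ d.+1 j.+1 = (1 - p d) * pi_ d.+1 j + p d * pi_ d j.
Proof. by []. Qed.

Lemma geom_sum_kernelS d j : tau d.+1 j.+1 =
  (1 - p d) * tau d.+1 j
  + (p d * tau d j + geom_ratio d * pi_ d.+1 j.+1).
Proof. by []. Qed.

Lemma geom_sum_kernel2S d j : rho d.+1 j.+1 =
  (1 - p d) * rho d.+1 j + (p d * rho d j
   + (2 * geom_ratio d * tau d.+1 j.+1 - geom_ratio d ^+ 2 * pi_ d.+1 j.+1)).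
Proof. by []. Qed.

Lemma geom_sum_meanS d : mean d.+1 = mean d + (p d)^-1.
Proof. by rewrite /mean big_ord_recr. Qed.

Lemma geom_sum_varianceS d : var d.+1 = var d + (1 - p d) / p d ^+ 2.
Proof. by rewrite /var big_ord_recr. Qed.

Lemma geom_sum_pmf_at0 d : pi_ d.+1 0 = 0. Proof. by []. Qed.
Lemma geom_sum_kernel_at0 d : tau d 0 = 0. Proof. by case: d. Qed.

Section Positive.
Variable r : nat.
Hypothesis p01 : forall d, (d < r)%N -> 0 < p d <= 1.

Let q01 d : (d < r)%N -> 0 <= 1 - p d < 1.
Proof. by move=> /p01; lra. Qed.

Let pn0 d : (d < r)%N -> p d != 0.
Proof. by move=> /p01/andP[/gt_eqF ->]. Qed.

Lemma geom_ratio_ge0 d : (d < r)%N -> 0 <= geom_ratio d.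
Proof.
move=> dr; have /andP[p0 p1] := p01 dr.
by rewrite divr_ge0 ?(ltW p0)// subr_ge0.
Qed.

Lemma geom_sum_pmf_ge0 d : (d <= r)%N -> forall j, 0 <= pi_ d j.
Proof.
elim: d => [|d IH] dr j; first by rewrite /= ler0n.
have /andP[p0 p1] := p01 dr.
apply: geom_filter_ge0; first by rewrite subr_ge0.
by move=> i; rewrite mulr_ge0 ?(ltW p0)// IH// ltnW.
Qed.

Lemma geom_sum_kernel_ge0 d : (d <= r)%N -> forall j, 0 <= tau d j.
Proof.
elim: d => [|d IH] dr j //.
have /andP[p0 p1] := p01 dr.
apply: geom_filter_ge0; first by rewrite subr_ge0.
move=> i; rewrite addr_ge0// mulr_ge0 ?(ltW p0) ?IH 1?ltnW//.
  exact: geom_ratio_ge0.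
exact: (geom_sum_pmf_ge0 dr i.+1).
Qed.

(* [E((T - s)^2; W = j) >= 0]. *)
Lemma geom_sum_square_ge0 d : (d <= r)%N -> forall j s,
  0 <= rho d j - 2 * s * tau d j + s ^+ 2 * pi_ d j.
Proof.
elim: d => [|d IH] dr j s.
  by rewrite /= mulr0 subr0 add0r mulr_ge0// ?sqr_ge0 ?ler0n.
have /andP[p0 p1] := p01 dr.
elim: j s => [|j IHj] s; first by rewrite /= !mulr0 subr0 addr0.
(* Whether [G = 1] or [G = 1 + G'], one copy of [geom_ratio d] is added to [T]; both hypotheses are
   therefore used at the shifted centre and averaged with weights [1 - p d] and [p d]. *)
have := IHj (s - geom_ratio d); have := IH (ltnW dr) j (s - geom_ratio d).
rewrite geom_sum_kernel2S geom_sum_kernelS geom_sum_pmfS.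
set c := geom_ratio d; set r1 := rho d.+1 j; set r0 := rho d j.
set t1 := tau d.+1 j; set t0 := tau d j.
set b1 := pi_ d.+1 j; set b0 := pi_ d j => h0 h1.
have := ler_wpM2l (ltW p0) h0; rewrite mulr0.
have := @ler_wpM2l _ (1 - p d) _ _ _ h1; rewrite mulr0 subr_ge0 => /(_ p1).
set e1 := (1 - p d) * _; set e0 := p d * _ => h1' h0'.
have := addr_ge0 h0' h1'; congr (0 <= _).
rewrite /e0 /e1; ring.
Qed.

Lemma cvg_geom_sum_pmf d : (d <= r)%N -> series (pi_ d) @ \oo --> (1 : R).
Proof.
elim: d => [|d IH] dr.
  apply: (@cvg_near_cst _ R^o); exists 1%N => // -[|N] // _.
  by rewrite /series /= big_nat_recl//= big1 ?addr0.
have := @cvg_series_geom_filter _ (1 - p d) (fun i => p d * pi_ d i)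
  (p d) (q01 dr).
rewrite subKr divff ?pn0//; apply.
rewrite -[X in _ --> X]mulr1.
have -> : series (fun i => p d * pi_ d i) = (fun N => p d * series (pi_ d) N).
  by apply/funext => N; rewrite /series /= mulr_sumr.
by apply: cvgMr; exact: IH (ltnW dr).
Qed.

(** The mean of [(q / p) G] is [q / p^2], which is the variance of [G]. *)
Lemma cvg_geom_sum_kernel d : (d <= r)%N -> series (tau d) @ \oo --> var d.
Proof.
elim: d => [|d IH] dr.
  rewrite /var big_ord0; apply: (@cvg_near_cst _ R^o).
  by apply: nearW => N; rewrite /series /= big1.
have := cvg_series_lin (a := p d) (b := geom_ratio d) (IH (ltnW dr))
  (cvg_series_shift (geom_sum_pmf_at0 d) (cvg_geom_sum_pmf dr)).
move=> /(cvg_series_geom_filter (q01 dr)).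
rewrite subKr [X in _ --> X -> _](_ : _ = var d.+1)//.
by rewrite geom_sum_varianceS /geom_ratio; field; rewrite pn0.
Qed.

(* [E T^2], where [Var T = sum q^3 / p^4]. *)
Lemma cvg_geom_sum_kernel2 d : (d <= r)%N -> series (rho d) @ \oo -->
  var d ^+ 2 + \sum_(i < d) geom_ratio i ^+ 2 * ((1 - p i) / p i ^+ 2).
Proof.
elim: d => [|d IH] dr.
  rewrite /var !big_ord0 expr0n addr0; apply: (@cvg_near_cst _ R^o).
  by apply: nearW => N; rewrite /series /= big1.
have h := cvg_series_lin (a := 2 * geom_ratio d) (b := - geom_ratio d ^+ 2)
  (cvg_series_shift (geom_sum_kernel_at0 d.+1) (cvg_geom_sum_kernel dr))
  (cvg_series_shift (geom_sum_pmf_at0 d) (cvg_geom_sum_pmf dr)).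
have := cvg_series_lin (a := p d) (b := 1) (IH (ltnW dr)) h.
move=> /(cvg_series_geom_filter (q01 dr)).
rewrite subKr; under [X in geom_filter _ X]eq_fun do rewrite mul1r mulNr.
rewrite [X in _ --> X -> _](_ : _ = var d.+1 ^+ 2 +
  \sum_(i < d.+1) geom_ratio i ^+ 2 * ((1 - p i) / p i ^+ 2))//.
rewrite big_ord_recr /= geom_sum_varianceS /geom_ratio.
by field; rewrite pn0.
Qed.

(* [tau] is the Stein kernel: [(j - mean) P(W = j)] telescopes. *)
Lemma geom_sum_stein d : (d <= r)%N -> forall j,
  tau d j - tau d j.+1 = (j.+1%:R - mean d) * pi_ d j.+1.
Proof.
elim: d => [|d IH] dr j; first by rewrite /= subr0 mulr0.
elim: j => [|j IHj].
  rewrite geom_sum_kernelS geom_sum_pmfS !geom_sum_kernel_at0 geom_sum_pmf_at0.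
  rewrite geom_sum_meanS.
  case: d dr IH => [|d] dr IH; last by rewrite geom_sum_pmf_at0; ring.
  by rewrite /mean big_ord0 /geom_ratio /=; field; rewrite pn0.
have {}IH := IH (ltnW dr) j.
rewrite geom_sum_kernelS [tau d.+1 j.+2]geom_sum_kernelS.
(* The induction hypotheses move [tau] from [j] to [j.+1]; these values cancel against the expansion
   of [tau d.+1 j.+2], leaving an identity in [pi_ d.+1 j.+1] and [pi_ d j.+1]. *)
rewrite [X in X - _](_ : _ = (1 - p d) * (tau d.+1 j.+1
  + (j.+1%:R - mean d.+1) * pi_ d.+1 j.+1)
  + (p d * (tau d j.+1 + (j.+1%:R - mean d) * pi_ d j.+1)
  + geom_ratio d * pi_ d.+1 j.+1)); last first.
  by rewrite -IH -IHj; ring.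
rewrite geom_sum_meanS [pi_ d.+1 j.+2]geom_sum_pmfS /geom_ratio.
set x := pi_ d.+1 j.+1; set y := pi_ d j.+1.
rewrite -[j.+2]add1n natrD; field; exact: pn0.
Qed.

End Positive.
End GeometricSum.

(** * The normal distribution and Stein's equation *)

Section StandardNormal.
Variable R : realType.
Implicit Types (w x y z : R).

Notation Phi := (@std_normal_cdf R).
Notation K := (Num.sqrt (2 * pi) : R).

Lemma MVT_derive (f df : R -> R) (a b : R) : a <= b ->
  (forall x, a <= x <= b -> is_derive x 1 f (df x)) ->
  exists2 c, a <= c <= b & f b - f a = df c * (b - a).
Proof.
move=> ab fd.
have [||c cab ->] := @MVT_segment R f df a b ab.
- by move=> x; rewrite in_itv/= => /andP[/ltW ax /ltW xb]; apply: fd; rewrite ax.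
- apply: derivable_within_continuous => x; rewrite in_itv/= => /fd H.
  exact: (@ex_derive _ _ _ _ _ _ _ H).
- by exists c => //; move: cab; rewrite in_itv.
Qed.

Lemma sqrt_2pi_ge1 : 1 <= K.
Proof. by rewrite -[leLHS]sqrtr1 ler_sqrt//; have := pi_ge2 R; lra. Qed.

(** The crude bound [pi <= 4] suffices. Half of this 3 becomes the bound [3 / 2] on the Stein
    solution. *)
Lemma sqrt_2pi_le3 : K <= 3.
Proof.
rewrite -[leRHS]ger0_norm// -sqrtr_sqr ler_sqrt ?sqr_ge0//.
have [/andP[_ +] _] := pihalf_02_cos_pihalf R.
rewrite expr2; lra.
Qed.

Definition std_normal_pdf x : R := K^-1 * expR (- (x ^+ 2) / 2).
Notation phi := std_normal_pdf.

Lemma std_normal_pdfE : normal_pdf 0 1 = phi.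
Proof.
apply/funext => x; rewrite /normal_pdf oner_eq0 /phi /normal_peak /normal_fun.
by rewrite expr1n mul1r subr0 -mulr_natl.
Qed.

Lemma integrable_std_normal_pdf x :
  lebesgue_measure.-integrable `]-oo, x] (EFin \o phi).
Proof.
rewrite -std_normal_pdfE.
by apply: (@integrableS _ _ _ _ setT) => //; exact: integrable_normal_pdf.
Qed.

Lemma std_normal_cdfE x : (Phi x)%:E = normal_prob 0 1 `]-oo, x].
Proof.
rewrite -[RHS]fineK ?fin_num_measure//; congr EFin.
rewrite /normal_prob std_normal_pdfE /std_normal_cdf /phi.
rewrite -RintegralZl//.
have := integrable_std_normal_pdf x; move=> /(@integrableZl _ _ _ _ _ _ K).
move=> /(_ (measurable_itv _)).
apply: eq_integrable => //= y _; rewrite /phi -EFinM mulrA divff ?mul1r//.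
by rewrite gt_eqF// (lt_le_trans _ sqrt_2pi_ge1).
Qed.

Lemma std_normal_cdf_ge0 x : 0 <= Phi x.
Proof. by rewrite -lee_fin std_normal_cdfE. Qed.

Lemma std_normal_cdf_le1 x : Phi x <= 1.
Proof. by rewrite -lee_fin std_normal_cdfE probability_le1. Qed.

Lemma is_derive_std_normal_cdf x : is_derive x 1 Phi (phi x).
Proof.
have intf := integrable_std_normal_pdf.
have := @continuous_FTC1 R phi -oo%O x (x + 1) _ (intf _).
rewrite ltrDl ltr01 => /(_ isT) /=.
have -> : (fun x0 => \int[lebesgue_measure]_(t in `]-oo, x0]) phi t) = Phi.
  apply/funext => y; apply/EFin_inj; rewrite std_normal_cdfE /normal_prob.
  by rewrite std_normal_pdfE /Rintegral fineK// integrable_fin_num//; apply: intf.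
case.
- by rewrite ltNyr.
- by rewrite -std_normal_pdfE; apply: continuous_normal_pdf; rewrite oner_eq0.
- by move=> dP <-; rewrite derive1E; exact/derivableP.
Qed.

(** The identity, seen as a random variable under the normal law, makes [Phi] a [cdf], whose limits
    at infinity are known. *)
Let id_R : measurableTypeR R -> R := idfun.

#[local] HB.instance Definition _ :=
  @isMeasurableFun.Build _ _ _ _ id_R (@measurable_id _ _ setT).

Lemma std_normal_cdf_id :
  cdf (id_R : {RV (@normal_prob R 0 1) >-> R}) = EFin \o Phi.
Proof. by apply/funext => x; rewrite /= std_normal_cdfE. Qed.

Lemma cvg_std_normal_cdfNy : Phi x @[x --> -oo] --> (0 : R).
Proof.
have := cvg_cdfNy0 (id_R : {RV (@normal_prob R 0 1) >-> R}).
by rewrite std_normal_cdf_id => /fine_cvgP[].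
Qed.

Lemma cvg_std_normal_cdfy : Phi x @[x --> +oo] --> (1 : R).
Proof.
have := cvg_cdfy1 (id_R : {RV (@normal_prob R 0 1) >-> R}).
by rewrite std_normal_cdf_id => /fine_cvgP[].
Qed.

(** As [phi] is even, [Phi y + Phi (- y)] has derivative 0, hence equals its limit 1 at [+oo]. *)
Lemma std_normal_cdfN x : Phi (- x) = 1 - Phi x.
Proof.
suff H y : Phi y + Phi (- y) = 1 by rewrite -(H x) addrC addKr.
have cst z : Phi z + Phi (- z) = Phi y + Phi (- y).
  apply: (@is_derive_0_is_cst R (fun z => Phi z + Phi (- z))) => t.
  have h1 : is_derive t 1 (fun z : R => Phi (- z)) (phi (- t) * - 1).
    exact: (@is_derive1_comp R Phi -%R t _ _ (is_derive_std_normal_cdf _)).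
  have := is_deriveD (is_derive_std_normal_cdf t) h1.
  by rewrite /phi sqrrN mulrN1 subrr.
have : (Phi z + Phi (- z)) @[z --> +oo] --> (1 + 0 : R).
  apply: cvgD; first exact: cvg_std_normal_cdfy.
  by have := cvg_std_normal_cdfNy; rewrite cvgNy_compNP.
under eq_fun do rewrite cst.
rewrite addr0 => h; apply/esym.
by apply: (@cvg_unique _ _ _ _ _ _ h) => //; exact: cvg_cst.
Qed.

Lemma std_normal_pdf_ge0 x : 0 <= phi x.
Proof. by rewrite mulr_ge0 ?expR_ge0// invr_ge0 sqrtr_ge0. Qed.

Lemma std_normal_pdf_le1 x : phi x <= 1.
Proof.
rewrite mulr_ile1 ?invr_ge0 ?expR_ge0 ?sqrtr_ge0//.
  by rewrite invf_le1 ?sqrt_2pi_ge1// (lt_le_trans _ sqrt_2pi_ge1).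
by rewrite expR_le1 mulNr oppr_le0 divr_ge0 ?sqr_ge0.
Qed.

Lemma std_normal_cdf_lipschitz x y : x <= y -> 0 <= Phi y - Phi x <= y - x.
Proof.
move=> xy; have [|c _ ->] := @MVT_derive Phi phi x y xy.
  by move=> ? _; exact: is_derive_std_normal_cdf.
have := std_normal_pdf_ge0 c; have := std_normal_pdf_le1 c.
have yx : 0 <= y - x by rewrite subr_ge0.
nra.
Qed.

(** This is [Phi w / phi w], the usual Mills ratio taken at [- w]. It solves [psi' = w psi + 1], and
    both branches of the Stein solution are multiples of it, reflected on the right. *)
Definition mills_ratio w : R := K * expR (w ^+ 2 / 2) * Phi w.
Notation psi := mills_ratio.

Lemma sqrt_2pi_neq0 : K != 0.
Proof. by rewrite gt_eqF// (lt_le_trans _ sqrt_2pi_ge1). Qed.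

Lemma mills_ratio_ge0 w : 0 <= psi w.
Proof.
by rewrite mulr_ge0 ?std_normal_cdf_ge0// mulr_ge0 ?expR_ge0 ?sqrtr_ge0.
Qed.

Lemma is_derive_mills_ratio w : is_derive w 1 psi (w * psi w + 1).
Proof.
have d2 : is_derive w 1 (fun x : R => x ^+ 2 / 2) w.
  have := is_deriveM (is_deriveX 2 (is_derive_id w 1))
    (is_derive_cst (2^-1 : R) w 1).
  move=> h; apply: (is_derive_eq h); rewrite /= /GRing.scale /=; lra.
have de := @is_derive1_comp R expR (fun x => x ^+ 2 / 2) w _ _
  (is_derive_expR _) d2.
have dK := is_deriveM (is_derive_cst K w 1) de.
have := is_deriveM dK (is_derive_std_normal_cdf w).
move=> h; apply: (is_derive_eq h).
rewrite /psi /phi /GRing.scale /= mulr0 addr0.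
have -> : K * expR (w ^+ 2 / 2) * (K^-1 * expR (- w ^+ 2 / 2)) = 1.
  rewrite mulrACA divff ?sqrt_2pi_neq0// mul1r -expRD mulNr subrr expR0//.
ring.
Qed.

(** [u = Phi + phi / x] has derivative [- phi / x^2 <= 0] on the negative axis, so
    [u w <= u x <= Phi x] for every [x <= w], and [Phi x] tends to 0 at [-oo]. *)
Lemma std_normal_cdf_mills w : w < 0 -> Phi w <= - (phi w / w).
Proof.
move=> w0; pose u x : R := Phi x + phi x / x.
have du x : x < 0 -> is_derive x 1 u (- (phi x / x ^+ 2)).
  move=> x0; have xn0 : x != 0 by rewrite lt_eqF.
  have d2 : is_derive x 1 (fun x : R => - (x ^+ 2) / 2) (- x).
    have := is_deriveM (is_deriveN (is_deriveX 2 (is_derive_id x 1)))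
      (is_derive_cst (2^-1 : R) x 1).
    move=> h; apply: (is_derive_eq h); rewrite /= /GRing.scale /=; lra.
  have de := @is_derive1_comp R expR (fun x => - (x ^+ 2) / 2) x _ _
    (is_derive_expR _) d2.
  have dp := is_deriveM (is_derive_cst K^-1 x 1) de.
  have dq := is_deriveM dp (@is_deriveV R id x 1 1 xn0 (is_derive_id x 1)).
  have := is_deriveD (is_derive_std_normal_cdf x) dq.
  move=> h; apply: (is_derive_eq h).
  rewrite /phi /GRing.scale /= mulr0 addr0.
  rewrite -[(cst _ * _) x]/(K^-1 * expR (- x ^+ 2 / 2)).
  by field; rewrite sqrt_2pi_neq0 xn0.
have uw x : x <= w -> u w <= Phi x.
  move=> xw; have [c /andP[_ cw]|c _ e] :=
      @MVT_derive u (fun x => - (phi x / x ^+ 2)) x w xw.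
    by apply: du; exact: le_lt_trans w0.
  have ux : u x <= Phi x.
    rewrite gerDl mulr_ge0_le0 ?std_normal_pdf_ge0// invr_le0.
    exact: le_trans xw (ltW w0).
  apply: le_trans ux; rewrite -subr_le0 e mulr_le0_ge0 ?subr_ge0//.
  by rewrite oppr_le0 divr_ge0 ?sqr_ge0 ?std_normal_pdf_ge0.
suff : u w <= 0 by rewrite /u; lra.
rewrite -(cvg_lim (@Rhausdorff R) cvg_std_normal_cdfNy); apply: limr_ge.
  by apply: cvgP; exact: cvg_std_normal_cdfNy.
by near=> x; apply: uw; near: x; apply: nbhs_ninfty_le; rewrite num_real.
Unshelve. all: by end_near. Qed.

(** For [w < 0] this is the Mills inequality divided by [phi w] and multiplied by [w]. It makes
    [psi] nondecreasing. *)
Lemma mills_ratio_deriv_ge0 w : 0 <= w * psi w + 1.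
Proof.
have [w0|w0] := leP 0 w; first by rewrite addr_ge0// mulr_ge0 ?mills_ratio_ge0.
have := std_normal_cdf_mills w0.
rewrite -(@ler_pM2l _ (K * expR (w ^+ 2 / 2))); last first.
  by rewrite mulr_gt0 ?expR_gt0// (lt_le_trans _ sqrt_2pi_ge1).
rewrite -/(psi w) mulrN mulrA.
have -> : K * expR (w ^+ 2 / 2) * phi w = 1.
  by rewrite /phi mulrACA divff ?sqrt_2pi_neq0// mul1r -expRD mulNr subrr expR0.
rewrite mul1r => h; have : w * (- w^-1) <= w * psi w by rewrite ler_nM2l.
by rewrite mulrN divff ?lt_eqF//; lra.
Qed.

Lemma mills_ratio_le w : w <= 0 -> psi w <= 3 / 2.
Proof.
move=> w0; have [|c _ e] := @MVT_derive psi (fun x => x * psi x + 1) w 0 w0.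
  by move=> x _; exact: is_derive_mills_ratio.
have : psi w <= psi 0.
  by rewrite -subr_ge0 e mulr_ge0 ?mills_ratio_deriv_ge0// subr_ge0.
have := @std_normal_cdfN 0; rewrite oppr0 {2}/psi expr0n mul0r expR0 mulr1.
by have := sqrt_2pi_le3; nra.
Qed.

(* The bounded solution of [f'(w) = w f(w) + (w <= z) - Phi(z)]. *)
Definition stein_solution z w : R :=
  if w <= z then psi w * (1 - Phi z) else psi (- w) * Phi z.
Notation stein := stein_solution.

(** For [w <= 0] the bounds on [psi] apply directly. For [0 < w <= z], [1 - Phi z <= Phi (- w)]
    gives [psi w * (1 - Phi z) <= psi (- w)], a value at a negative argument. *)
Lemma stein_solution_left_bound z w : w <= z ->
  0 <= psi w * (1 - Phi z) <= 3 / 2 /\ `|w * (psi w * (1 - Phi z))| <= 1.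
Proof.
move=> wz; have := std_normal_cdf_le1 z; have := std_normal_cdf_ge0 z.
have := mills_ratio_ge0 w => p0 f0 f1.
have [w0|w0] := leP w 0.
  have := mills_ratio_le w0; have := mills_ratio_deriv_ge0 w => h1 h2.
  split; first by apply/andP; split; nra.
  by rewrite mulrA ler_norml; apply/andP; split; nra.
have : psi w * (1 - Phi z) <= psi (- w).
  apply: (@le_trans _ _ (psi w * (1 - Phi w))).
    by rewrite ler_wpM2l// lerD2l lerN2; have := std_normal_cdf_lipschitz wz; lra.
  have fw1 := std_normal_cdf_le1 w.
  rewrite -std_normal_cdfN /psi sqrrN mulrAC ler_piMr//.
  by rewrite mulr_ge0 ?std_normal_cdf_ge0// mulr_ge0 ?expR_ge0 ?sqrtr_ge0.
have : 0 <= psi w * (1 - Phi z) by rewrite mulr_ge0// subr_ge0.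
have := mills_ratio_deriv_ge0 (- w).
have := @mills_ratio_le (- w); rewrite oppr_le0 (ltW w0) => /(_ isT).
set a := psi w * _ => h1 h2 h3 h4; split; first by apply/andP; split; nra.
by rewrite ler_norml; apply/andP; split; nra.
Qed.

(** The two branches agree at [w = z], so the right one is valid at [z] too. *)
Lemma stein_solution_right z w : z <= w -> stein z w = psi (- w) * Phi z.
Proof.
rewrite /stein le_eqVlt => /predU1P[->|]; last by case: ltP.
rewrite lexx -std_normal_cdfN /psi sqrrN; ring.
Qed.

Lemma stein_solution_bound z w :
  0 <= stein z w <= 3 / 2 /\ `|w * stein z w| <= 1.
Proof.
have [wz|/ltW zw] := leP w z.
  by rewrite /stein wz; exact: stein_solution_left_bound.
rewrite stein_solution_right//.
(* The right branch is the left one reflected through [(z, w) -> (- z, - w)]. *)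
have := @stein_solution_left_bound (- z) (- w); rewrite lerN2 => /(_ zw).
by rewrite std_normal_cdfN subKr mulNr normrN.
Qed.

(** Here [g] is the Stein solution, with a kink at [z], and [f] a smooth branch equal to it on
    [[a, a + h]]. The derivative [x g + c] is at most 2 in absolute value, and its variation from
    [a] is [(x - a) g x + a (g x - g a)]. *)
Lemma stein_increment (f g : R -> R) (c a h : R) : 0 <= h -> `|c| <= 1 ->
  (forall x, a <= x <= a + h -> g x = f x) ->
  (forall x, a <= x <= a + h -> is_derive x 1 f (x * g x + c)) ->
  (forall x, `|g x| <= 3 / 2) -> (forall x, `|x * g x| <= 1) ->
  `|g (a + h) - g a| <= 2 * h /\
  `|g (a + h) - g a - h * (a * g a + c)| <= h ^+ 2 * (3 / 2 + 2 * `|a|).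
Proof.
move=> h0 c1 gf df g32 xg1.
have aah : a <= a <= a + h by rewrite lexx lerDl h0.
have inc b : a <= b <= a + h -> exists2 x, a <= x <= a + h &
    g b - g a = (x * g x + c) * (b - a).
  move=> /andP[ab bh].
  have [x /andP[ax xb]|x /andP[ax xb] e] :=
      @MVT_derive f (fun x => x * g x + c) a b ab.
    by apply: df; rewrite ax (le_trans xb).
  by exists x; rewrite ?ax ?(le_trans xb)// (gf b) ?ab ?bh// (gf a).
have inc2 b : a <= b <= a + h -> `|g b - g a| <= 2 * h.
  move=> ab; have [x _ ->] := inc b ab; have xf := xg1 x.
  move: ab => /andP[ab bh].
  rewrite normrM (@ger0_norm _ (b - a)) ?subr_ge0//.
  apply: ler_pM; rewrite ?subr_ge0 ?lerBlDl//.
  by rewrite (le_trans (ler_normD _ _))//; lra.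
have ah : a <= a + h <= a + h by rewrite lexx lerDl h0.
split; first exact: inc2.
have [x xah ->] := inc (a + h) ah.
have -> : (x * g x + c) * (a + h - a) - h * (a * g a + c) =
  h * ((x - a) * g x + a * (g x - g a)) by ring.
have -> : h ^+ 2 * (3 / 2 + 2 * `|a|) = h * (h * (3 / 2) + `|a| * (2 * h)).
  by ring.
rewrite normrM (ger0_norm h0) ler_wpM2l// (le_trans (ler_normD _ _))//.
rewrite lerD// normrM.
  move: xah => /andP[ax xb]; rewrite (@ger0_norm _ (x - a)) ?subr_ge0//.
  by apply: ler_pM; rewrite ?subr_ge0 ?lerBlDl.
by rewrite ler_wpM2l// inc2.
Qed.

(** As [z] is not interior to [[a, a + h]], one branch holds on all of it. The indicator is strict
    because at [a = z] the interval lies on the right of the kink. *)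
Lemma stein_solution_increment (z a h : R) : 0 <= h -> (a + h <= z) || (z <= a) ->
  `|stein z (a + h) - stein z a| <= 2 * h /\
  `|stein z (a + h) - stein z a - h * (a * stein z a + ((a < z)%R%:R - Phi z))|
    <= h ^+ 2 * (3 / 2 + 2 * `|a|).
Proof.
move=> h0; have f0 := std_normal_cdf_ge0 z; have f1 := std_normal_cdf_le1 z.
(* Apart, since [a + h <= z] yields [a < z] only for [h > 0]. *)
have [->|hn0] := eqVneq h 0.
  by rewrite addr0 subrr normr0 !mulr0 mul0r subr0 normr0 expr0n mul0r.
have hp : 0 < h by rewrite lt_neqAle eq_sym hn0.
have sle x : `|stein z x| <= 3 / 2.
  by have [/andP[s0 s1] _] := stein_solution_bound z x; rewrite ger0_norm.
have sxle x : `|x * stein z x| <= 1 by have [_] := stein_solution_bound z x.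
case/orP=> [ahz|za].
  have az : a < z by apply: lt_le_trans ahz; rewrite ltrDl.
  have E x : a <= x <= a + h -> stein z x = psi x * (1 - Phi z).
    by move=> /andP[_ xh]; rewrite /stein (le_trans xh).
  rewrite az; apply: (stein_increment h0 _ E _ sle sxle).
    by rewrite ger0_norm ?subr_ge0//= gerBl.
  move=> x xah.
  have h' := is_deriveM (is_derive_mills_ratio x) (is_derive_cst (1 - Phi z) x 1).
  apply: (is_derive_eq h').
  by rewrite /GRing.scale /= mulr0 add0r /cst (E _ xah); ring.
have E x : a <= x <= a + h -> stein z x = psi (- x) * Phi z.
  by move=> /andP[ax _]; rewrite stein_solution_right// (le_trans za).
rewrite ltNge za; apply: (stein_increment h0 _ E _ sle sxle).
  by rewrite sub0r normrN ger0_norm.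
move=> x xah.
have d1 := @is_derive1_comp R psi -%R x _ _ (is_derive_mills_ratio (- x))
  (is_deriveN (is_derive_id x 1)).
have h' := is_deriveM d1 (is_derive_cst (Phi z) x 1).
apply: (is_derive_eq h').
by rewrite /GRing.scale /= mulr0 add0r /cst (E _ xah); ring.
Qed.

End StandardNormal.

(** * Normal approximation of a sum of geometric variables *)

Section BerryEsseen.
Variables (R : realType) (p : R ^nat) (r : nat).
Hypothesis p01 : forall d, (d < r)%N -> 0 < p d <= 1.

Notation Phi := (@std_normal_cdf R).
Notation pi_ := (geom_sum_pmf p r).
Notation tau := (geom_sum_kernel p r).
Notation rho := (geom_sum_kernel2 p r).
Notation mu := (geom_sum_mean p r).
Notation var := (geom_sum_variance p r).

Let pi_ge0 : forall j, 0 <= pi_ j.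
Proof. exact: (geom_sum_pmf_ge0 p01 (leqnn r)). Qed.

Let tau_ge0 : forall j, 0 <= tau j.
Proof. exact: (geom_sum_kernel_ge0 p01 (leqnn r)). Qed.

Let sum_pi N : \sum_(0 <= j < N) pi_ j <= 1.
Proof.
by apply: series_le_lim => //; exact: (cvg_geom_sum_pmf p01 (leqnn r)).
Qed.

Let sum_tau N : \sum_(0 <= j < N) tau j <= var.
Proof.
by apply: series_le_lim => //; exact: (cvg_geom_sum_kernel p01 (leqnn r)).
Qed.

(** Summation by parts with [geom_sum_stein]; truncation at [N] leaves the boundary term
    [tau N * g N.+1]. *)
Lemma geom_sum_stein_identity (g : nat -> R) N :
  \sum_(0 <= j < N.+1) (j%:R - mu) * pi_ j * g j =
  \sum_(0 <= j < N.+1) tau j * (g j.+1 - g j) - tau N * g N.+1.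
Proof.
elim: N => [|N IH].
  rewrite !big_nat1 geom_sum_kernel_at0 !mul0r subr0.
  case: (r) => [|d]; last by rewrite geom_sum_pmf_at0 mulr0 mul0r.
  by rewrite /geom_sum_mean big_ord0 subrr !mul0r.
rewrite big_nat_recr//= IH -(geom_sum_stein p01 (leqnn r)).
by rewrite [in RHS]big_nat_recr//=; ring.
Qed.

(** In the Stein identity for [g j = j - mu] the increments of [g] are 1, so the sum of [tau]
    remains, and that is at most [var]. *)
Lemma geom_sum_second_moment N :
  \sum_(0 <= j < N) (j%:R - mu) ^+ 2 * pi_ j <= var.
Proof.
(* Truncating beyond [mu] makes the boundary term [- tau M * (M.+1 - mu)] nonpositive. *)
pose M := maxn N (Num.truncn mu).
have muM : mu <= M.+1%:R.
  by rewrite (le_trans (ltW (truncnS_gt _)))// ler_nat ltnS leq_maxr.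
apply: (@le_trans _ _ (\sum_(0 <= j < M.+1) (j%:R - mu) ^+ 2 * pi_ j)).
  apply: (@nondecreasing_series _ (fun j => (j%:R - mu) ^+ 2 * pi_ j) xpredT 0).
    by move=> j _ _; rewrite mulr_ge0 ?sqr_ge0.
  by rewrite leqW// leq_maxl.
under eq_bigr do rewrite expr2 mulrAC.
rewrite (geom_sum_stein_identity (fun j => j%:R - mu)).
rewrite lerBlDr (le_trans _ (lerD (sum_tau M.+1) (lexx _)))//.
have -> : \sum_(0 <= j < M.+1) tau j * (j.+1%:R - mu - (j%:R - mu)) =
    \sum_(0 <= j < M.+1) tau j.
  apply: eq_bigr => j _; rewrite -[j.+1]add1n natrD; ring.
by rewrite lerDl mulr_ge0// subr_ge0.
Qed.

(** The sum is the L1 norm of [E(var - T | W)]. It is controlled by [Var T <= A^2 var = B^2] through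
    [2 B |t| <= t^2 + B^2], which plays the part of Cauchy-Schwarz. *)
Lemma geom_sum_kernel_deviation (A : R) : 0 < A -> 0 < var ->
  (forall d, (d < r)%N -> geom_ratio p d <= A) ->
  forall N, \sum_(0 <= j < N) `|var * pi_ j - tau j| <= A * Num.sqrt var.
Proof.
move=> A0 V0 cA N; set B := A * Num.sqrt var.
have B0 : 0 < B by rewrite mulr_gt0// sqrtr_gt0.
have B20 : 0 < 2 * B by rewrite pmulr_rgt0.
have B2 : B ^+ 2 = A ^+ 2 * var by rewrite exprMn sqr_sqrtr// ltW.
(* [u j] is [E((T - var)^2 + B^2; W = j)]; the squares centred at [var + B] and [var - B] give the
   two signs in [u_ge]. *)
pose u j := rho j - 2 * var * tau j + var ^+ 2 * pi_ j + B ^+ 2 * pi_ j.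
have pos := geom_sum_square_ge0 p01 (leqnn r).
have u_ge j : `|var * pi_ j - tau j| <= (2 * B)^-1 * u j.
  rewrite ler_norml lerNl [_^-1 * _]mulrC !ler_pdivlMr ?B20// /u.
  have := pos j (var + B); have := pos j (var - B).
  move: (rho j) (tau j) (pi_ j) => a b c h1 h2.
  by apply/andP; split; nra.
apply: (@le_trans _ _ (\sum_(0 <= j < N) (2 * B)^-1 * u j)).
  by apply: ler_sum => j _; exact: u_ge.
rewrite -mulr_sumr [leLHS]mulrC ler_pdivrMr ?B20//.
have cu := cvg_series_lin (a := 1) (b := var ^+ 2 + B ^+ 2)
  (cvg_series_lin (a := 1) (b := - (2 * var))
    (cvg_geom_sum_kernel2 p01 (leqnn r)) (cvg_geom_sum_kernel p01 (leqnn r)))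
  (cvg_geom_sum_pmf p01 (leqnn r)).
have {cu} : series u @ \oo --> \sum_(i < r) geom_ratio p i ^+ 2 *
    ((1 - p i) / p i ^+ 2) + B ^+ 2.
  rewrite [X in _ --> X](_ : _ = 1 * (1 * (var ^+ 2 +
    \sum_(i < r) geom_ratio p i ^+ 2 * ((1 - p i) / p i ^+ 2))
    + - (2 * var) * var) + (var ^+ 2 + B ^+ 2) * 1); last by ring.
  rewrite (_ : u = fun i => 1 * (1 * rho i + - (2 * var) * tau i)
    + (var ^+ 2 + B ^+ 2) * pi_ i)//.
  by apply/funext => j; rewrite /u; ring.
move=> /series_le_lim/(_ N)/le_trans; apply.
  move=> j; have := le_trans (normr_ge0 _) (u_ge j).
  by rewrite pmulr_rge0// invr_gt0 mulr_gt0.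
rewrite [leRHS](_ : _ = B ^+ 2 + B ^+ 2); last by ring.
rewrite lerD2r B2 mulr_sumr; apply: ler_sum => i _.
have /andP[p0 p1] := p01 (ltn_ord i).
rewrite ler_wpM2r ?divr_ge0 ?sqr_ge0 ?subr_ge0//.
by rewrite lerXn2r ?nnegrE ?(ltW A0) ?(geom_ratio_ge0 p01) ?cA.
Qed.

(* The normalisation of [W] sends [j] to [z], so that the left-hand side is
   [`|P(W < J) - Phi(z)|] at a lattice point [z]. *)
Lemma geom_sum_berry_esseen (A : R) (J : nat) : 0 < A -> 0 < var ->
  (forall d, (d < r)%N -> geom_ratio p d <= A) ->
  `|\sum_(0 <= j < J) pi_ j - Phi ((J%:R - mu) / Num.sqrt var)|
    <= (2 * A + 7 / 2) / Num.sqrt var.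
Proof.
move=> A0 V0 cA; set s := Num.sqrt var.
have [h hE] : exists h, h = s^-1 by exists s^-1.
have s0 : 0 < s by rewrite sqrtr_gt0.
have h0 : 0 < h by rewrite hE invr_gt0.
have h2V : h ^+ 2 * var = 1.
  by rewrite hE exprVn /s sqr_sqrtr ?(ltW V0)// mulVf ?gt_eqF.
pose x (j : nat) := (j%:R - mu) * h; pose z := x J.
pose g j := stein_solution z (x j).
have xS j : x j.+1 = x j + h by rewrite /x -[j.+1]addn1 natrD; ring.
rewrite -hE -/(x J) -/z.
have Phi0 := std_normal_cdf_ge0 z; have Phi1 := std_normal_cdf_le1 z.
move: (Phi z) (fun j => @stein_solution_increment R z (x j) h (ltW h0)) Phi0 Phi1
  => F dg F0 F1.
have xz j : (x j < z) = (j < J)%N by rewrite /z /x ltr_pM2r// ltrD2r ltr_nat.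
have {}dg j : `|g j.+1 - g j| <= 2 * h /\
    `|g j.+1 - g j - h * (x j * g j + ((j < J)%N%:R - F))|
      <= h ^+ 2 * (3 / 2 + 2 * `|x j|).
  (* [z] is the lattice point [x J], hence never strictly between [x j] and [x j.+1]. *)
  rewrite /g xS -xz; apply: dg; rewrite -xS /z /x !ler_pM2r// !lerD2r !ler_nat.
  by case: ltnP.
have g32 j : `|g j| <= 3 / 2.
  by have [/andP[a b] _] := stein_solution_bound z (x j); rewrite ger0_norm.
(* From [|x| <= (1 + x^2) / 2] and a normalised second moment of at most 1. *)
have sum_x N : \sum_(0 <= j < N) `|x j| * pi_ j <= 1.
  apply: (@le_trans _ _ (\sum_(0 <= j < N)
      2^-1 * (pi_ j + h ^+ 2 * ((j%:R - mu) ^+ 2 * pi_ j)))).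
    apply: ler_sum => j _; rewrite mulrA -exprMn_comm; last exact: mulrC.
    rewrite [h * _]mulrC -/(x j) -(normr_id (x j)) -real_normK ?num_real//.
    have := pi_ge0 j; have := sqr_ge0 (`|x j| - 1); rewrite normr_id; nra.
  rewrite -mulr_sumr big_split -mulr_sumr /=.
  have := sum_pi N; have := geom_sum_second_moment N.
  by move/(ler_wpM2l (sqr_ge0 h)); rewrite h2V; lra.
have sum_dev N : \sum_(0 <= j < N) `|pi_ j - h ^+ 2 * tau j| <= A * h.
  have := geom_sum_kernel_deviation A0 V0 cA N.
  move/(ler_wpM2l (sqr_ge0 h)).
  rewrite [X in _ <= X -> _](_ : _ = A * h); last first.
    by rewrite -/s hE; field; rewrite gt_eqF.
  apply: le_trans; rewrite mulr_sumr; apply: ler_sum => j _.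
  rewrite -{2}(ger0_norm (sqr_ge0 h)) -normrM mulrBr mulrA h2V mul1r//.
(* The truncated estimate; its last term comes from the boundary of the Stein identity and vanishes
   as [N] grows. *)
have key N : `|\sum_(0 <= j < N.+1) (j < J)%N%:R * pi_ j
      - F * \sum_(0 <= j < N.+1) pi_ j|
    <= (2 * A + 7 / 2) * h + 3 / 2 * h * tau N.
  set L := _ - _.
  pose e j := g j.+1 - g j - h * (x j * g j + ((j < J)%N%:R - F)).
  (* The indicator minus [F] is eliminated through [e j]; the part
     [h * x j * g j = h^2 (j - mu) g j] is then rewritten by the Stein identity. *)
  have hL : h * L = - (\sum_(0 <= j < N.+1) e j * pi_ j)
      + (\sum_(0 <= j < N.+1) (g j.+1 - g j) * (pi_ j - h ^+ 2 * tau j))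
      + h ^+ 2 * tau N * g N.+1.
    have H : tau N * g N.+1 = \sum_(0 <= j < N.+1)
        (tau j * (g j.+1 - g j) - (j%:R - mu) * pi_ j * g j).
      by rewrite sumrB geom_sum_stein_identity; ring.
    rewrite -mulrA H /L [F * _]mulr_sumr -sumrB !mulr_sumr -sumrN -!big_split /=.
    by apply: eq_bigr => j _; rewrite /e /x; ring.
  rewrite -(ler_pM2l h0) -[X in X * `|L|](gtr0_norm h0) -normrM hL.
  rewrite (le_trans (ler_normD _ _))//.
  (* [7 / 2] is [3 / 2] times the total mass bound plus 2 times the bound on [E|x|]; [2 A] combines
     the increment bound [2 h] with [sum_dev]. *)
  rewrite [leRHS](_ : _ = (h ^+ 2 * (3 / 2 * 1 + 2 * 1) + 2 * h * (A * h))
    + h ^+ 2 * tau N * (3 / 2)); last by field.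
  apply: lerD; last first.
    have ht0 : 0 <= h ^+ 2 * tau N by exact: mulr_ge0 (sqr_ge0 h) (tau_ge0 N).
    by rewrite normrM (ger0_norm ht0) ler_wpM2l.
  rewrite (le_trans (ler_normD _ _))// normrN; apply: lerD.
    apply: (@le_trans _ _ (\sum_(0 <= j < N.+1)
        h ^+ 2 * (3 / 2 * pi_ j + 2 * (`|x j| * pi_ j)))).
      rewrite (le_trans (ler_norm_sum _ _ _))//; apply: ler_sum => j _.
      rewrite normrM (ger0_norm (pi_ge0 j)) [2 * _]mulrA -mulrDl mulrA.
      by rewrite ler_wpM2r//; have [] := dg j.
    rewrite -mulr_sumr ler_wpM2l ?sqr_ge0// big_split -!mulr_sumr /=.
    by apply: lerD; rewrite ler_wpM2l.
  apply: (@le_trans _ _ (\sum_(0 <= j < N.+1)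
      2 * h * `|pi_ j - h ^+ 2 * tau j|)).
    rewrite (le_trans (ler_norm_sum _ _ _))//; apply: ler_sum => j _.
    by rewrite normrM ler_wpM2r//; have [] := dg j.
  by rewrite -mulr_sumr ler_wpM2l// mulr_ge0// ltW.
have cpi := cvg_geom_sum_pmf p01 (leqnn r).
have ctau := cvg_geom_sum_kernel p01 (leqnn r).
have tau0 : tau N @[N --> \oo] --> 0.
  by apply: cvg_series_cvg_0; apply: cvgP ctau.
set S := \sum_(0 <= j < J) pi_ j.
have cR : (2 * A + 7 / 2) * h + 3 / 2 * h * tau N @[N --> \oo]
    --> (2 * A + 7 / 2) * h + 3 / 2 * h * 0.
  by apply: cvgD; [exact: cvg_cst|apply: cvgMr].
have cL : `|S - F * \sum_(0 <= j < N.+1) pi_ j| @[N --> \oo] --> `|S - F * 1|.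
  apply: cvg_norm; apply: cvgB; first exact: cvg_cst.
  by apply: cvgMr; rewrite (cvg_shiftS (series pi_)).
have := ler_cvg_to cL cR; rewrite !mulr1 mulr0 addr0; apply.
exists J => // N /= JN; have := key N; congr (`|_ - _| <= _).
rewrite (@big_cat_nat _ _ _ J 0 N.+1)//= ?(leqW JN)//.
rewrite [X in _ + X]big1_seq ?addr0; last first.
  move=> j; rewrite mem_index_iota => /andP[_ /andP[Jj _]].
  by rewrite ltnNge Jj mul0r.
rewrite /S big_nat [RHS]big_nat.
by apply: eq_bigr => j /andP[_ ->]; rewrite mul1r.
Qed.

End BerryEsseen.

(** * The number of distinct coupons *)

Section CouponDraws.
Context d (T : measurableType d) (R : realType) (P : probability T R) (n : nat).
Variable X : nat -> T -> 'I_n.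
Hypothesis hX : coupon_draws P X.

Definition draw_word (t : nat) (w : T) : t.-tuple 'I_n :=
  map_tuple (X^~ w) (iota_tuple t 0).

(** Puts a cylinder in the shape in which independence is stated. The default [k0] of [nth] will be
    [thead a], so the empty word is treated apart. *)
Lemma draw_wordP (k0 : 'I_n) t (a : t.-tuple 'I_n) (J : {fset nat}) :
  J =i iota 0 t ->
  draw_word t @^-1` [set a] =
  \bigcap_(i in [set` J]) (X i @^-1` [set nth k0 a i]).
Proof.
move=> JE; apply/seteqP; split => w /=.
  move=> <- i /=; rewrite JE mem_iota add0n /= => it.
  by rewrite (nth_map 0%N) ?size_iota// nth_iota.
move=> h; apply/val_inj/(@eq_from_nth _ k0); rewrite !size_tuple// => i it.
rewrite (nth_map 0%N) ?size_iota// nth_iota//; apply: h => /=.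
by rewrite JE mem_iota.
Qed.

Lemma draw_word0 (a : 0.-tuple 'I_n) : draw_word 0 @^-1` [set a] = setT.
Proof.
apply/seteqP; split => // w _.
exact: (etrans (tuple0 _) (esym (tuple0 _))).
Qed.

Lemma measurable_draw_word t (a : t.-tuple 'I_n) :
  measurable (draw_word t @^-1` [set a]).
Proof.
case: t a => [|t] a.
  by rewrite draw_word0.
rewrite (draw_wordP (thead a) a (seq_fsetE tt _)).
apply: fin_bigcap_measurable => // i _.
exact: (draws_measurable hX).
Qed.

Lemma prob_draw_word t (a : t.-tuple 'I_n) :
  P (draw_word t @^-1` [set a]) = (n%:R^-1 ^+ t)%:E.
Proof.
case: t a => [|t] a.
  by rewrite draw_word0 probability_setT expr0.
rewrite (draw_wordP (thead a) a (seq_fsetE tt _)).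
rewrite (draws_independent hX _ (fun i => [set nth (thead a) a i])).
under eq_bigr do rewrite (draws_uniform hX).
rewrite prodEFin; congr EFin.
rewrite big_const_seq count_predT size_seq_fset undup_id ?iota_uniq//.
by rewrite size_iota iter_mulr mulr1.
Qed.

(** An event on the first [t] draws is a finite disjoint union of equiprobable cylinders, so its
    probability is a count of words. *)
Lemma prob_draw_word_pred t (phi : pred (seq 'I_n)) :
  P [set w | phi (draw_word t w)] =
  (n%:R^-1 ^+ t * \sum_(a : t.-tuple 'I_n) (phi a)%:R)%:E.
Proof.
pose F (a : t.-tuple 'I_n) := if phi a then draw_word t @^-1` [set a] else set0.
have -> : [set w | phi (draw_word t w)] = \bigcup_(a in [set: t.-tuple 'I_n]) F a.
  apply/seteqP; split => [w pw|w [a _]].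
    by exists (draw_word t w) => //; rewrite /F (pw : phi _ = true).
  by rewrite /F; case: ifP => // pa wa; rewrite -(wa : _ = a) in pa.
rewrite measure_fin_bigcup//.
- rewrite (@fsbigE _ _ _ _ _ (enum {: t.-tuple 'I_n}))//; last first.
  - by move=> a _; rewrite mem_enum.
  - exact: enum_uniq.
  rewrite big_enum_cond /=; under eq_bigl do rewrite in_setT.
  rewrite mulr_sumr -sumEFin; apply: eq_bigr => a _.
  by rewrite /F; case: ifP; rewrite ?measure0 ?mulr0// prob_draw_word mulr1.
- by apply: finite_finset.
- apply/trivIsetP => a b _ _ ab; apply/seteqP; split => // w [].
  rewrite /F; case: ifP => // _ wa; case: ifP => // _ wb.
  by rewrite -(wa : _ = a) -(wb : _ = b) eqxx in ab.
- by move=> a _; rewrite /F; case: ifP => // _; exact: measurable_draw_word.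
Qed.

Lemma sum_tuple_cons t (f : seq 'I_n -> R) :
  \sum_(a : t.+1.-tuple 'I_n) f a =
  \sum_(a : t.-tuple 'I_n) \sum_(k < n) f (k :: a).
Proof.
rewrite pair_big /=.
rewrite (reindex (fun u : t.-tuple 'I_n * 'I_n => [tuple of u.2 :: u.1]))//=.
exists (fun a : t.+1.-tuple 'I_n => ([tuple of behead a], thead a)).
  by move=> [a k] _ /=; congr (_, _); exact/val_inj.
by move=> a _ /=; apply/esym; rewrite [LHS]tuple_eta.
Qed.

(** If [s] has more than [e] distinct letters, all [n] choices of [k] count; if exactly [e], only
    the [n - e] new letters; if fewer, none. *)
Lemma sum_distinct_cons (s : seq 'I_n) (e : nat) :
  \sum_(k < n) (e < size (undup (k :: s)))%N%:R =
  (n%:R - e%:R) * (e <= size (undup s))%N%:R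
  + e%:R * (e < size (undup s))%N%:R :> R.
Proof.
have ss : size (undup s) = #|[pred k | k \in s]|.
  rewrite -(card_uniqP (undup_uniq s)); apply: eq_card => k.
  by rewrite !inE mem_undup.
have sn : (size (undup s) <= n)%N by rewrite ss -[leqRHS]card_ord max_card.
rewrite /=.
have [es|es|es] := ltngtP e (size (undup s)).
- rewrite (eq_bigr (fun=> 1)); last first.
    by move=> k _; case: ifP => _ /=; rewrite ?es// ltnS ltnW.
  by rewrite sumr_const card_ord !mulr1 subrK.
- rewrite !mulr0 addr0 big1// => k _; case: ifP => _ /=.
    by rewrite ltnNge (ltnW es).
  by rewrite ltnS leqNgt es.
rewrite (eq_bigr (fun k => (k \notin s)%:R)); last first.
  by move=> k _; case: (k \in s); rewrite /= es ?ltnn ?ltnSn.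
have -> : \sum_(k < n) (k \notin s)%:R = #|[predC [pred k | k \in s]]|%:R :> R.
  rewrite -sum1_card natr_sum [in RHS]big_mkcond.
  by apply: eq_bigr => k _; rewrite inE /=; case: (k \in s).
have := cardC [pred k | k \in s]; rewrite card_ord -ss -es.
move=> /(congr1 (fun i => i%:R : R)).
by rewrite natrD mulr1 mulr0 addr0 => <-; rewrite addrC addKr.
Qed.


(* Probability that a draw brings a new coupon when [e] are already known. *)
Definition coupon_prob (e : nat) : R := (n%:R - e%:R) / n%:R.

(** Conditioning on one letter of the word, [sum_distinct_cons] gives the probabilities the same
    recurrence in [t] as [series_geom_filter] gives the partial sums. *)
Lemma prob_num_distinct_ge e t :
  P [set w | (e <= num_distinct X t w)%N] =
  (\sum_(0 <= j < t.+1) geom_sum_pmf coupon_prob e j)%:E.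
Proof.
have n0 : n%:R != 0 :> R.
  (* A probability space is nonempty, so [X 0] takes a value in ['I_n] and [n] cannot be 0. *)
  have [w _] : [set: T] !=set0.
    apply/set0P/eqP => T0; have := probability_setT P.
    by rewrite T0 measure0 => /(congr1 fine)/esym/eqP; rewrite /= oner_eq0.
  by rewrite pnatr_eq0; case: (n) (X 0 w) => // -[].
rewrite (prob_draw_word_pred t (fun s => e <= size (undup s))%N); congr EFin.
elim: e t => [|e IHe] t.
  rewrite (eq_bigr (fun=> 1))// sumr_const card_tuple card_ord.
  rewrite big_nat_recl//= big1// addr0 natrX exprVn mulVf//.
  by rewrite expf_eq0 (negbTE n0) andbF.
elim: t => [|t IHt].
  rewrite big_nat1 geom_sum_pmf_at0 big1 ?mulr0// => a _.
  by rewrite tuple0.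
rewrite (sum_tuple_cons t (fun s => (e < size (undup s))%N%:R)).
under eq_bigr do rewrite sum_distinct_cons.
have -> : \sum_(0 <= j < t.+2) geom_sum_pmf coupon_prob e.+1 j =
    (1 - coupon_prob e) * \sum_(0 <= j < t.+1) geom_sum_pmf coupon_prob e.+1 j
    + coupon_prob e * \sum_(0 <= j < t.+1) geom_sum_pmf coupon_prob e j.
  rewrite [coupon_prob e * _]mulr_sumr.
  exact: (series_geom_filter (1 - coupon_prob e)).
rewrite -IHt -IHe big_split -!mulr_sumr /= /coupon_prob.
set A := \sum_(i : t.-tuple _) _; set B := \sum_(i : t.-tuple _) _.
by rewrite exprS; field.
Qed.

End CouponDraws.

(** * The waiting time *)

Section WaitingTime.
Context (T : Type) (R : realType) (n : nat) (X : nat -> T -> 'I_n).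

Lemma num_distinctS t w :
  (num_distinct X t w <= num_distinct X t.+1 w <= (num_distinct X t w).+1)%N.
Proof.
rewrite /num_distinct -addn1 iotaD map_cat cats1; set s := map _ _.
rewrite (perm_size (perm_undup (mem_rcons s _))) /=.
by case: ifP => _ /=; rewrite ?leqnn ?leqnSn.
Qed.

Lemma num_distinct_homo w : 
  {homo (fun t => num_distinct X t w) : s t / (s <= t)%N}.
Proof.
by apply: homo_leq leqnn leq_trans _ => t; have /andP[] := num_distinctS t w.
Qed.

(** A discrete intermediate value property: the count starts at 0 and grows by at most 1. It links
    the equality in [waiting_time] to an inequality. *)
Lemma num_distinct_hit w e t : (e <= num_distinct X t w)%N ->
  exists2 s, (s <= t)%N & num_distinct X s w = e.
Proof.
elim: t => [|t IH] et; first by exists 0%N => //; move: et; rewrite leqn0 => /eqP.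
have [/IH[s st <-]|te] := leqP e (num_distinct X t w).
  by exists s => //; exact: leqW.
exists t.+1 => //; apply/eqP; rewrite eqn_leq et andbT.
by have /andP[_] := num_distinctS t w => /leq_trans; apply.
Qed.

Lemma waiting_time_leP m w (y : R) :
  (waiting_time R X m w <= y%:E)%E <->
  0 <= y /\ (n - m <= num_distinct X (Num.truncn y) w)%N.
Proof.
split=> [Wy|[y0 /num_distinct_hit[s st sm]]]; last first.
  apply: ge_ereal_inf; exists s%:R%:E; first by exists s.
  by rewrite lee_fin -truncn_ge_nat.
have [s sy sm] : exists2 s : nat, s%:R <= y & num_distinct X s w = (n - m)%N.
  (* [J] is the first natural number above [y]. Without a hitting time up to [y], all are at least
     [J], and so is the infimum, even over the empty set. *)
  apply: contrapT => no; pose J := if 0 <= y then (Num.truncn y).+1 else 0%N.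
  have yJ : y < J%:R.
    by rewrite /J; case: ifP => [_|/negbT]; [exact: truncnS_gt|rewrite -ltNge].
  move: Wy; apply/negP; rewrite -ltNge.
  apply: (@lt_le_trans _ _ (J%:R%:E)); first by rewrite lte_fin.
  apply/ereal_infP => _ [s /= sm <-]; rewrite lee_fin ler_nat leqNgt.
  apply/negP => sJ; apply: no; exists s => //.
  by move: sJ; rewrite /J; case: ifP => // y0; rewrite ltnS truncn_ge_nat.
have y0 : 0 <= y := le_trans (ler0n _ _) sy.
by split => //; rewrite -sm; apply: num_distinct_homo; rewrite truncn_ge_nat.
Qed.

End WaitingTime.

Lemma le_standardized (R : realType) (W : \bar R) (mu s x : R) : 0 < s ->
  ((W - mu%:E) * (s^-1)%:E <= x%:E)%E = (W <= (mu + s * x)%:E)%E.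
Proof.
move=> s0; have s1 : 0 < s^-1 by rewrite invr_gt0.
case: W => [w| |].
- rewrite -EFinB -EFinM !lee_fin ler_pdivrMr// lerBlDl [x * s]mulrC//.
- by rewrite addye// gt0_mulye ?lte_fin// !leye_eq.
- by rewrite addNye gt0_mulNye ?lte_fin// !leNye.
Qed.

(** * Mean, variance and success probabilities of the coupon collector *)

Section CouponParameters.
Variables (R : realType) (n : nat).
Notation p := (coupon_prob R n).

(** Passes from the number [k] of missing coupons to the number [d = n - k] of coupons held, the
    index of [coupon_prob]. *)
Lemma coupon_sum_rev (F : nat -> R) m : (m <= n)%N ->
  \sum_(m.+1 <= k < n.+1) F k = \sum_(d < n - m) F (n - d)%N.
Proof.
move=> mn; rewrite big_nat_rev -[m.+1 in LHS]add0n big_addn big_mkord subSS.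
by apply: eq_bigr => i _; congr F; rewrite add0n; lia.
Qed.

Lemma coupon_prob_itv m d : (1 <= m <= n)%N -> (d < n - m)%N -> 0 < p d <= 1.
Proof.
move=> /andP[m0 mn] dnm; have dn : (d < n)%N by lia.
have n0 : 0 < n%:R :> R by rewrite ltr0n; lia.
rewrite divr_gt0 ?subr_gt0 ?ltr_nat//= ler_pdivrMr// mul1r gerBl//.
Qed.

Lemma coupon_meanE m : (1 <= m <= n)%N ->
  coupon_mean R n m = geom_sum_mean p (n - m).
Proof.
move=> /andP[m0 mn]; rewrite /coupon_mean coupon_sum_rev// mulr_sumr.
apply: eq_bigr => -[d /= dnm] _; rewrite /coupon_prob invf_div natrB//; lia.
Qed.

Lemma coupon_varianceE m : (1 <= m <= n)%N ->
  coupon_variance R n m = geom_sum_variance p (n - m).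
Proof.
move=> /andP[m0 mn]; rewrite /coupon_variance.
rewrite (coupon_sum_rev (fun k => (n%:R - k%:R) / k%:R ^+ 2))// mulr_sumr.
apply: eq_bigr => -[d /= dnm] _; rewrite /coupon_prob natrB; last by lia.
have n0 : n%:R != 0 :> R by rewrite pnatr_eq0; lia.
have dn : n%:R - d%:R != 0 :> R.
  by rewrite -natrB ?pnatr_eq0; lia.
by field; rewrite n0 dn.
Qed.

(** [q / p <= 1 / p], and each success probability is at least [m / n]. The factor [n / m] of the
    final bound originates here. *)
Lemma coupon_geom_ratio_le m d : (1 <= m <= n)%N -> (d < n - m)%N ->
  geom_ratio p d <= n%:R / m%:R.
Proof.
move=> mn dnm; have /andP[p0 p1] := coupon_prob_itv mn dnm.
case/andP: mn => m0 mn.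
have n0 : 0 < n%:R :> R by rewrite ltr0n; lia.
have mR : 0 < m%:R :> R by rewrite ltr0n.
have mp : m%:R / n%:R <= p d.
  by rewrite ler_pM2r ?invr_gt0// -natrB ?ler_nat; lia.
apply: (@le_trans _ _ (p d)^-1).
  by rewrite /geom_ratio ler_piMl ?invr_ge0 ?(ltW p0)// gerBl ltW.
by rewrite -invf_div lef_pV2// posrE ?divr_gt0.
Qed.

(** The first draw is always new and contributes 0; [m <= n - 2] ensures that the term [d = 1], of
    parameter [(n - 1) / n < 1], is present. *)
Lemma coupon_variance_gt0 m : (1 <= m <= n - 2)%N -> 0 < coupon_variance R n m.
Proof.
move=> mn2; have mn : (1 <= m <= n)%N by lia.
rewrite coupon_varianceE//.
have d1 : (1 < n - m)%N by lia.
rewrite /geom_sum_variance (bigD1 (Ordinal d1))//=.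
have n0 : 0 < n%:R :> R by rewrite ltr0n; lia.
have /andP[p0 p1] := coupon_prob_itv mn d1.
rewrite ltr_wpDr//.
  apply: sumr_ge0 => i _; have /andP[q0 q1] := coupon_prob_itv mn (ltn_ord i).
  by rewrite divr_ge0 ?sqr_ge0// subr_ge0.
rewrite divr_gt0 ?exprn_gt0// subr_gt0 /coupon_prob ltr_pdivrMr// mul1r.
by rewrite ltrBlDr ltrDl.
Qed.

End CouponParameters.

(** * The distribution function of the waiting time and the uniform estimate *)

Lemma coupon_cdfE (R : realType) d (T : measurableType d) (P : probability T R)
    (n m : nat) (X : nat -> T -> 'I_n) (x : R) :
  coupon_draws P X -> 0 < coupon_sd R n m ->
  let y := coupon_mean R n m + coupon_sd R n m * x in
  coupon_cdf P X m x =
  \sum_(0 <= j < if 0 <= y then (Num.truncn y).+1 else 0%N)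
    geom_sum_pmf (coupon_prob R n) (n - m) j.
Proof.
move=> hX sd0 y; rewrite /coupon_cdf.
under eq_set do rewrite le_standardized//.
rewrite -/y; case: leP => y0; last first.
  rewrite big_geq// (_ : [set _ | _] = set0) ?measure0//.
  apply/seteqP; split => // w /= /waiting_time_leP[y0' _].
  by rewrite ltNge y0' in y0.
rewrite -[RHS]/(fine (_%:E)) -(prob_num_distinct_ge hX); congr (fine (P _)).
by apply/seteqP; split => w /=; rewrite waiting_time_leP => // -[].
Qed.

Theorem theorem4p0p1 (R : realType) (d : measure_display)
    (T : measurableType d) (P : probability T R) (n m : nat)
    (X : nat -> T -> 'I_n) (hX : coupon_draws P X)
    (hn : (3 <= n)%N) (hm : (1 <= m <= n - 2)%N) :
  (ereal_sup [set (`| coupon_cdf P X m x - std_normal_cdf x |)%:E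
               | x in [set: R]]
   <= ((9 + 257 / 1000) * (n%:R / m%:R) * (coupon_sd R n m)^-1)%:E)%E.
Proof.
have mn : (1 <= m <= n)%N by lia.
have V0 : 0 < coupon_variance R n m := coupon_variance_gt0 R hm.
have s0 : 0 < coupon_sd R n m by rewrite sqrtr_gt0.
apply: ge_ereal_sup => _ [x _ <-]; rewrite lee_fin (coupon_cdfE _ hX s0).
set mu := coupon_mean R n m; set s := coupon_sd R n m.
set A : R := n%:R / m%:R.
have A1 : 1 <= A.
  by rewrite ler_pdivlMr ?mul1r ?ler_nat ?ltr0n; lia.
have A0 : 0 < A by apply: lt_le_trans A1.
have clt J := @geom_sum_berry_esseen R (coupon_prob R n) (n - m)
  (fun e => @coupon_prob_itv R n m e mn) A J A0.
rewrite -coupon_varianceE// -coupon_meanE// in clt.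
have {}clt J := clt J V0 (fun e => @coupon_geom_ratio_le R n m e mn).
rewrite -[Num.sqrt _]/s -/mu in clt.
(* The added [s^-1] pays for the distance from [x] to the lattice. As [1 <= A],
   [2 A + 9 / 2 <= (13 / 2) A], below the stated constant. *)
apply: (@le_trans _ _ ((2 * A + 7 / 2) / s + s^-1)); last first.
  by rewrite -[X in _ + X]mul1r -mulrDl ler_wpM2r ?invr_ge0 ?(ltW s0)//; lra.
have si0 : 0 < s^-1 by rewrite invr_gt0.
pose y := mu + s * x; have yE : y = mu + s * x by [].
have xE : x = (y - mu) / s.
  by rewrite /y; field; rewrite gt_eqF.
rewrite -/y; move: y yE xE => y _ ->; have [y0|y0] := leP 0 y.
  (* The first integer above [y] is at distance at most 1, and [Phi] is 1-Lipschitz. *)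
  have /andP[ty yt] := truncn_itv y0.
  have /std_normal_cdf_lipschitz/andP[lip0 lip] :
      (y - mu) / s <= ((Num.truncn y).+1%:R - mu) / s.
    by rewrite ler_pM2r// lerD2r ltW.
  rewrite -(subrKA (std_normal_cdf (((Num.truncn y).+1%:R - mu) / s))).
  rewrite (le_trans (ler_normD _ _))// lerD//.
  rewrite (ger0_norm lip0) (le_trans lip)// -mulrBl -[leRHS]mul1r ler_pM2r//.
  by move: ty; rewrite -[_.+1]addn1 natrD; lra.
(* For [y < 0] the distribution function is 0, and [Phi] at [x] is at most its value at the lattice
   point [- mu / s] of [J = 0], which the estimate bounds. *)
have := clt 0%N; rewrite !big_geq// !sub0r !normrN.
rewrite !ger0_norm ?std_normal_cdf_ge0// => B.
have /std_normal_cdf_lipschitz/andP[+ _] : (y - mu) / s <= - mu / s.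
  by rewrite ler_pM2r// gerDr ltW.
by rewrite subr_ge0 => /le_trans; apply; rewrite ler_wpDr ?(ltW si0).
Qed.
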